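(* For a zero-dimensional Tychonoff space $X$ the following assertions are equivalent: (1) $C_p(X,\mathbb{Q})$ is S-separable; (2) $C_p(X,\mathbb{Z})$ is S-separable; (3) $C_p(X,2)$ is S-separable; (4) $iw(X)=\omega$ and every finite power of $X$ is Menger.
   Context: A space is zero-dimensional if it has a base of clopen sets. For a space $E$, $C_p(X,E)$ is the set of continuous functions $X\to E$ with the topology of pointwise convergence; $\mathbb{Q}$ and $\mathbb{Z}$ carry the usual topologies inherited from $\mathbb{R}$ and $2=\{0,1\}$ is discrete. A space $Z$ is S-separable if for every sequence $(Y_n)_{n\in\mathbb{N}}$ of dense subspaces of $Z$ there exists a sequence $(F_n)$ such that each $F_n$ is a finite subset of $Y_n$ and for each finite collection $\mathcal{F}$ of nonempty open sets of $Z$ there exists $n$ with $U\cap F_n\neq\emptyset$ for all $U\in\mathcal{F}$. $iw(X)$ is the least weight of a Tychonoff topology on $X$ contained in the topology of $X$; with the usual convention that cardinal functions take infinite values, $iw(X)=\omega$ means that $X$ has a coarser Tychonoff topology with a countable base. A space $Z$ is Menger if for every sequence $(\mathcal{U}_n)$ of open covers of $Z$ there are finite $\mathcal{V}_n\subseteq\mathcal{U}_n$ such that $\bigcup_n\mathcal{V}_n$ covers $Z$. *)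

(* Defs.v *)
From HB Require Import structures.
From mathcomp Require Import all_boot all_order all_algebra.
From mathcomp Require Import all_classical all_reals all_analysis.

Set Implicit Arguments.
Unset Strict Implicit.
Unset Printing Implicit Defensive.

Import numFieldTopology.Exports.
Local Open Scope classical_set_scope.
Local Open Scope ring_scope.

(* Beware: the library's [zero_dimensional] only asks that distinct points be
   separated by a clopen set, which is weaker than having a clopen base. *)
Definition has_clopen_base (X : topologicalType) : Prop :=
  exists2 B : set (set X), basis B & B `<=` clopen.

Definition tychonoff_space (X : topologicalType) : Prop :=
  accessible_space X /\ completely_regular_space X.

(* [usual_rat R] and [usual_int R] have carriers [rat] and [int], with the
   topology inherited from [R] along the canonical embeddings. *)
Definition usual_rat (R : realType) : topologicalType :=
  initial_topology (fun q : rat => ratr q : R).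

Definition usual_int (R : realType) : topologicalType :=
  initial_topology (fun z : int => z%:~R : R).

Definition Cp (X E : topologicalType) : topologicalType :=
  initial_topology (fun f : continuousType X E => (f : {ptws X -> E})).

Definition S_separable (Z : topologicalType) : Prop :=
  forall Y : nat -> set Z, (forall n, dense (Y n)) ->
  exists F : nat -> set Z,
    (forall n, finite_set (F n) /\ F n `<=` Y n) /\
    (forall C : set (set Z), finite_set C ->
       (forall U, C U -> open U /\ U !=set0) ->
       exists n, forall U, C U -> (U `&` F n) !=set0).

Definition open_cover (Z : topologicalType) (U : set (set Z)) : Prop :=
  U `<=` open /\ \bigcup_(A in U) A = setT.

Definition Menger (Z : topologicalType) : Prop :=
  forall U : nat -> set (set Z), (forall n, open_cover (U n)) ->
  exists V : nat -> set (set Z),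
    (forall n, finite_set (V n) /\ V n `<=` U n) /\
    \bigcup_n \bigcup_(A in V n) A = setT.

(* Cardinal functions take infinite values by convention, so that
   [iw(X) = omega] is the existence of a topology on the carrier of [X] that is
   coarser than the one of [X], Tychonoff, and of countable (possibly finite)
   weight. *)
Definition iw_eq_omega (X : topologicalType) : Prop :=
  exists tau : Topological.axioms_ X,
    let X' : topologicalType := Topological.Pack tau in
    [/\ forall U : set X, @open X' U -> @open X U,
        tychonoff_space X' &
        @second_countable X'].

(* Main.v *)
(* All three function spaces satisfy the same criterion.

   If [Cp X E] is S-separable, [B] is clopen in [E], [e0] is in [B] and [e1] is
   not: a countable dense set of functions [f] gives countably many clopen sets
   [f @^-1` B], which separate the points of [X] and so generate a coarser
   second countable Tychonoff topology.  Given open covers [U k] of the [n]-th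
   power, the functions [f] for which the [n]-th power of [~` (f @^-1` B)] is
   covered by finitely many members of [U k] are dense: any function can be
   reset to [e0] outside a small clopen neighbourhood of a finite set.  A
   selection from these dense sets whose union is dense yields the finite
   subfamilies, because around the constant [e1] there is, for every point of
   the power, a selected function avoiding [B] at all its coordinates.

   Conversely, the square of [X] is Menger, hence Lindelof, so from [iw(X)]
   countable and zero-dimensionality one gets countably many clopen sets
   separating points, and then countably many functions [d k] interpolating
   every function on every finite set.  Given dense sets [Y n], a finite set [a]
   of indices [k] and a precision [q], the sets of [x] in the [p]-th power where
   a tuple of members of [Y n] is [1/(q+1)]-close to the [d k], [k] in [a], form
   an open cover; the Menger property of the powers selects finitely many tuples
   for each [n] in an infinite set of indices, and these sets are kept disjoint
   for the countably many triples [(a, p, q)]. *)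
Require Import Defs.
From HB Require Import structures.
From mathcomp Require Import all_boot all_order all_algebra.
From mathcomp Require Import all_classical all_reals all_analysis.

Set Implicit Arguments.
Unset Strict Implicit.
Unset Printing Implicit Defensive.

Import Order.TTheory GRing.Theory Num.Theory.
Import numFieldNormedType.Exports.

Local Open Scope classical_set_scope.
Local Open Scope ring_scope.

(** * Neighbourhoods in the topology of pointwise convergence *)

Lemma filter_mem_seq (I : eqType) (T : Type) (F : set_system T) (s : seq I)
    (P : I -> set T) :
  Filter F -> (forall i, i \in s -> F (P i)) ->
  F [set x | forall i, i \in s -> P i x].
Proof.
move=> FF; elim: s => [|i s IH] FP; first exact: filterS filterT.
have Fi : F (P i) by apply: FP; rewrite mem_head.
have /IH Fs : forall j, j \in s -> F (P j).
  by move=> j js; apply: FP; rewrite inE js orbT.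
by apply: filterS2 Fi Fs => x Pi Ps j; rewrite inE => /predU1P[->//|/Ps].
Qed.

(** [O] gives a neighbourhood at every index, even outside [s], so that two basic sets intersect by
    concatenating the lists and intersecting the families pointwise. *)
Lemma nbhs_ptwsP (I : eqType) (T : topologicalType) (f : {ptws I -> T})
    (A : set {ptws I -> T}) :
  nbhs f A <-> exists (s : seq I) (O : I -> set T),
    (forall i, nbhs (f i) (O i)) /\
    [set g : {ptws I -> T} | forall i, i \in s -> O i (g i)] `<=` A.
Proof.
split=> [|[s [ O [fO sub]]]]; last first.
  apply: (filterS sub); apply: filter_mem_seq => i _.
  exact: (@proj_continuous I (fun=> T) i f (O i) (fO i)).
pose F : set_system {ptws I -> T} := filter_from
  [set sO : seq I * (I -> set T) | forall i, nbhs (f i) (sO.2 i)]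
  (fun sO => [set g : {ptws I -> T} | forall i, i \in sO.1 -> sO.2 i (g i)]).
have FF : Filter F.
  apply: filter_from_filter.
    by exists ([::], fun=> setT) => i /=; exact: filterT.
  move=> [s O] [s' O'] /= fO fO'.
  exists (s ++ s', fun i => O i `&` O' i) => /= [i|g gO]; first exact: filterI.
  by split=> i si; have [] := gO i; rewrite ?mem_cat ?si ?orbT.
(* In the product topology, convergence of the filter [F] of basic sets can be tested one coordinate
   at a time. *)
have Ff : F --> f.
  apply/cvg_sup => i U [_ [[V oV <-] Vf VU]].
  exists ([:: i], fun j => if j == i then V else setT) => /= [j|g /(_ i)].
    case: eqP => [->|_]; last exact: filterT.
    exact: open_nbhs_nbhs.
  by rewrite mem_head eqxx => Vg; apply: VU; exact: Vg.
by move=> /Ff [[s O] /= fO sub]; exists s, O.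
Qed.

Lemma nbhs_CpP (X E : topologicalType) (f : Cp X E) (A : set (Cp X E)) :
  nbhs f A <-> exists (s : seq X) (O : X -> set E),
    (forall x, nbhs (f x) (O x)) /\
    [set g : Cp X E | forall x, x \in s -> O x (g x)] `<=` A.
Proof.
pose i (g : continuousType X E) : {ptws X -> E} := g.
have ci : continuous (i : Cp X E -> {ptws X -> E}).
  exact: initial_continuous.
split=> [[_ [[B oB <-] Bf BA]]|[s [ O [fO sub]]]]; last first.
  apply: (filterS sub).
  apply: (ci f [set g : {ptws X -> E} | forall x, x \in s -> O x (g x)]).
  by apply/nbhs_ptwsP; exists s, O; split.
have : nbhs (i f) B by exact: open_nbhs_nbhs.
by case/nbhs_ptwsP => s [ O [fO sub]]; exists s, O; split=> // g /sub /BA.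
Qed.

Lemma nbhs_Cp_eval (X E : topologicalType) (f : Cp X E) (x : X) (O : set E) :
  nbhs (f x) O -> nbhs f [set g : Cp X E | O (g x)].
Proof.
move=> fO; apply/nbhs_CpP; exists [:: x], (fun y => if y == x then O else setT).
split=> [y|g /(_ x)]; last by rewrite mem_head eqxx => /(_ isT).
by case: eqP => [->//|_]; exact: filterT.
Qed.

Lemma exists_Cp (X E : topologicalType) (f : X -> E) :
  continuous f -> exists g : Cp X E, forall x, g x = f x.
Proof. by move=> cf; exists (mkcts cf : continuousType X E). Qed.

(** * Clopen sets and indexed Menger covers *)

Lemma continuous_patch (X E : topologicalType) (W : set X) (f g : X -> E) :
  clopen W -> continuous f -> continuous g -> continuous (patch g W f).
Proof.
move=> [oW cW] cf cg x A; rewrite /patch.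
case: ifPn => [/set_mem Wx /cf fA|/negP xW /cg gA].
  have Wn : nbhs x W by exact: open_nbhs_nbhs.
  by apply: filterS2 Wn fA => y Wy; rewrite /= mem_set.
have Wn : nbhs x (~` W).
  by apply: open_nbhs_nbhs; split; [exact: closed_openC|move/mem_set].
by apply: filterS2 Wn gA => y Wy; rewrite /= memNset.
Qed.

Lemma clopen_nbhs (X : topologicalType) (x : X) (A : set X) :
  has_clopen_base X -> nbhs x A -> exists W, [/\ clopen W, W x & W `<=` A].
Proof.
move=> [B [_ /(_ x) bB] Bc] /bB [W [/Bc cW Wx] WA]; by exists W.
Qed.

Lemma clopen_separation (X : topologicalType) (x y : X) :
  has_clopen_base X -> accessible_space X -> x <> y ->
  exists W, [/\ clopen W, W x & ~ W y].
Proof.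
move=> zX aX /eqP /aX [A [oA /set_mem Ax /set_mem Ay]].
have [W [cW Wx WA]] : exists W, [/\ clopen W, W x & W `<=` A].
  by apply: clopen_nbhs => //; exact: open_nbhs_nbhs.
by exists W; split=> // /WA.
Qed.

(** The later covers are indexed by clopen sets or by tuples of functions, and the selection has to
    return finitely many indices rather than open sets; choice recovers an index from each selected
    set. *)
Lemma Menger_indexed (Z : topologicalType) (I : Type) (P : nat -> set I)
    (O : I -> set Z) :
  Menger Z -> (forall n i, P n i -> open (O i)) ->
  (forall n z, exists2 i, P n i & O i z) ->
  exists F : nat -> set I, (forall n, finite_set (F n) /\ F n `<=` P n) /\
    forall z, exists n, exists2 i, F n i & O i z.
Proof.
move=> mZ oO cO.
have [n|V [Vf Vc]] := mZ (fun n => O @` P n).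
  split=> [_ [i Pi <-]|]; first exact: (oO n).
  rewrite -subTset => z _; have [i Pi Oz] := cO n z.
  by exists (O i) => //; exists i.
(* [None] is the default outside [V], so that [I] need not be known to be inhabited. *)
have /choice[h hP] (nU : nat * set Z) : exists i : option I,
    V nU.1 nU.2 -> if i is Some j then P nU.1 j /\ O j = nU.2 else False.
  have [|nV] := pselect (V nU.1 nU.2); last by exists None.
  by move=> /(Vf nU.1).2 [i Pi Oi]; exists (Some i).
exists (fun n => [set i | exists2 U, V n U & h (n, U) = Some i]); split.
  move=> n; split; last first.
    by move=> i [U /(hP (n, U)) /=]; case: (h _) => // j [Pj _] [<-].
  have : finite_set (Some @^-1` ((fun U => h (n, U)) @` V n)).
    apply: finite_preimage; last by apply: finite_image; exact: (Vf n).1.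
    by move=> ? ? _ _ [].
  by apply: sub_finite_set => i [U VU hU]; exists U.
move=> z; have : [set: Z] z by [].
rewrite -Vc => -[n _ [U VU Uz]]; have := hP (n, U) VU.
case E : (h _) => [i|//] [/= Pi Oi]; exists n, i; last by rewrite Oi.
by exists U.
Qed.

(** * Coarser second countable topologies from clopen sets *)

Definition separates_points (X : topologicalType) (C : set (set X)) :=
  forall x y : X, x <> y -> exists2 W, C W & W x /\ ~ W y.

Lemma countable_clopen_enum (X : topologicalType) (C : set (set X)) :
  countable C -> C `<=` clopen ->
  exists W : nat -> set X, (forall n, clopen (W n)) /\ C `<=` range W.
Proof.
move=> /pfcard_geP[->|/unsquash h] Cc.
  by exists (fun=> set0); split=> // _; exact: clopen0.
exists h; split=> [n|U CU]; first by apply: Cc; exact: funS.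
by have [n _ <-] := @surj _ _ _ _ h U CU; exists n.
Qed.

(** Membership in the sets [W n] maps [X] continuously into the Cantor space. The topology pulled
    back along this map is uniformizable, hence completely regular; it is T1 by separation, and
    cylinders over finite lists form a countable base. *)
Lemma iw_eq_omega_separating (R : realType) (X : topologicalType)
    (C : set (set X)) :
  countable C -> C `<=` clopen -> separates_points C -> iw_eq_omega X.
Proof.
move=> Ccnt Cc Csep.
have [W [cW CW]] := countable_clopen_enum Ccnt Cc.
pose b (x : X) : {ptws nat -> bool} := fun n => x \in W n.
have cb : continuous b.
  move=> x A /nbhs_ptwsP[s [ O [bO sub]]].
  apply: (filterS (P := [set y | forall n, n \in s -> b y n = b x n])).
    by move=> y yx; apply: sub => n /yx ->; exact: nbhs_singleton.
  apply: filter_mem_seq => n _; rewrite /b.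
  have [oW cWn] := cW n.
  case: (boolP (x \in W n)) => [/set_mem Wx|/negP xW].
    have : nbhs x (W n) by exact: open_nbhs_nbhs.
    by apply: filterS => y Wy; exact: mem_set.
  have : nbhs x (~` W n).
    by apply: open_nbhs_nbhs; split; [exact: closed_openC|move/mem_set].
  by apply: filterS => y Wy; exact: memNset.
pose X' : uniformType := initial_topology b.
have open_coord n v : open [set x : X' | b x n = v].
  exists [set f : {ptws nat -> bool} | f n = v] => //.
  rewrite openE => f /= <-.
  apply: (@proj_continuous nat (fun=> bool) n f [set f n]).
  exact: (@discrete_set1 bool).
exists (Topological.class X'); split.
- move=> U [A oA <-]; move/continuousP: cb; exact.
- split; last exact: (@uniform_completely_regular R X').
  move=> x y /eqP /Csep [U /CW [n _ <-] [Wx Wy]].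
  exists [set x : X' | b x n = true]; split; first exact: open_coord.
    by apply/mem_set; rewrite /= /b mem_set.
  by apply/mem_set; rewrite /= /b memNset.
pose cyl (l : seq (nat * bool)) : set X' :=
  [set x | forall nv, nv \in l -> b x nv.1 = nv.2].
exists (range cyl).
  exact: (card_le_trans (card_image_le _ _) (countableP _)).
split.
  move=> _ [l _ <-]; rewrite openE => x lx.
  apply: (@filter_mem_seq _ X' (nbhs (x : X'))
    l (fun nv => [set x | b x nv.1 = nv.2])) => nv /lx bx.
  by apply: open_nbhs_nbhs; split=> //; exact: open_coord.
move=> x A [_ [[B oB <-] Bx BA]].
have : nbhs (b x) B by exact: open_nbhs_nbhs.
case/nbhs_ptwsP => s [ O [bO sub]].
exists (cyl [seq (n, b x n) | n <- s]).
  by split; [exists [seq (n, b x n) | n <- s]|move=> nv /mapP[n _ ->]].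
move=> y ly; apply: BA; apply: sub => n ns.
rewrite (_ : b y n = b x n); first exact: nbhs_singleton.
by apply: (ly (n, b x n)); apply/mapP; exists n.
Qed.

(** * Consequences of S-separability *)

Section necessity.
Variables (X E : topologicalType) (B : set E) (e0 e1 : E).
Hypotheses (zX : has_clopen_base X) (aX : accessible_space X).
Hypotheses (cB : clopen B) (Be0 : B e0) (nBe1 : ~ B e1).
Hypothesis sC : S_separable (Cp X E).

Let nbhs_B e : B e -> nbhs e B.
Proof. by move=> Be; apply: open_nbhs_nbhs; case: cB. Qed.

Let nbhs_nB e : ~ B e -> nbhs e (~` B).
Proof.
by move=> Be; apply: open_nbhs_nbhs; split=> //; have [] := clopenC _ cB.
Qed.

Lemma S_separable_Cp_separating :
  exists C : set (set X), [/\ countable C, C `<=` clopen & separates_points C].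
Proof.
(* For a constant sequence and singleton collections, S-separability is plain separability: the
   union of the [F n] is dense. *)
have [n|F [Ff Fd]] := @sC (fun=> setT).
  by move=> O O0 oO; rewrite setIT.
exists ((fun f : Cp X E => f @^-1` B) @` \bigcup_n F n); split.
- apply: card_le_trans (card_image_le _ _) _.
  apply: bigcup_countable => // n _.
  by apply: finite_set_countable; exact: (Ff n).1.
- by move=> _ [f _ <-]; apply: preimage_clopen => //; exact: cts_fun.
move=> x y xy.
pose O := [set f : Cp X E | B (f x) /\ ~ B (f y)].
have [|_ ->|n /(_ O erefl) [f [[Bx By] Fnf]]] := Fd [set O].
- exact: finite_set1.
- split.
    rewrite openE => f [Bx By]; 
    exact: (filterI (nbhs_Cp_eval (nbhs_B Bx)) (nbhs_Cp_eval (nbhs_nB By))).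
  have [W [cW Wy Wx]] := clopen_separation zX aX (nesym xy).
  have [g gE] := exists_Cp (continuous_patch cW (@cst_continuous X E e1)
    (@cst_continuous X E e0)).
  by exists g; rewrite /O /= !gE /patch memNset// mem_set.
by exists (f @^-1` B) => //; exists f => //; exists n.
Qed.

Lemma S_separable_Cp_Menger (n : nat) : Menger {ptws 'I_n -> X}.
Proof.
move=> U cU.
pose supp (f : Cp X E) : set {ptws 'I_n -> X} :=
  [set x | forall i, ~ B (f (x i))].
pose Y k : set (Cp X E) := [set f | exists V, [/\ finite_set V, V `<=` U k &
  supp f `<=` \bigcup_(A in V) A]].
have dY k : dense (Y k).
  move=> O [f Of] oO.
  have /nbhs_CpP[s [N [fN sub]]] : nbhs f O by exact: open_nbhs_nbhs.
  pose pt (t : {ffun 'I_n -> 'I_(size s)}) : {ptws 'I_n -> X} :=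
    fun i => tnth (in_tuple s) (t i).
  have /choice[A AP] t : exists A, U k A /\ exists M : 'I_n -> set X,
      (forall i, nbhs (pt t i) (M i)) /\
      (forall x : {ptws 'I_n -> X}, (forall i, M i (x i)) -> A x).
    have [oU cUT] := cU k; have : [set: {ptws 'I_n -> X}] (pt t) by [].
    rewrite -cUT => -[A UA At]; exists A; split=> //.
    have /nbhs_ptwsP[l [ M [tM MA]]] : nbhs (pt t) A.
      by apply: open_nbhs_nbhs; split=> //; exact: oU.
    by exists M; split=> // x Mx; apply: MA => i _; exact: Mx.
  have /choice[M MP] t := (AP t).2.
  (* [W j] is small enough for all tuples [t] and all coordinates [i] with [t i = j] at once, so the
     product of the [W (t i)] lies in [A t]. *)
  have /choice[W WP] (j : 'I_(size s)) : exists W, [/\ clopen W,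
      W (tnth (in_tuple s) j) &
      W `<=` [set y | forall (t : {ffun 'I_n -> 'I_(size s)}) i,
        t i = j -> M t i y]].
    apply: clopen_nbhs => //.
    apply: (@filter_forall _ _ (fun (t : {ffun 'I_n -> 'I_(size s)}) y =>
      forall i, t i = j -> M t i y)) => t.
    apply: (@filter_forall _ _ (fun i y => t i = j -> M t i y)) => i.
    have := (MP t).1 i; rewrite /pt; have [<-|tj _] := eqVneq (t i) j.
      by apply: filterS => y My _.
    by apply: filterE => y /eqP; rewrite (negPf tj).
  have cW : clopen (\bigcup_j W j).
    split; first by apply: bigcup_open => j _; have [[]] := WP j.
    by apply: closed_bigcup => [|j _]; [exact: finite_finset|have [[]] := WP j].
  (* Outside the union of the [W j] the value of [g] is [e0], so every point of [supp g] has all its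
     coordinates in that union and is covered by one of the finitely many [A t]. *)
  have [g gE] := exists_Cp (continuous_patch cW (@cts_fun _ _ f)
    (@cst_continuous X E e0)).
  exists g; split.
    apply: sub => x xs; rewrite /= gE /patch mem_set.
      exact: nbhs_singleton.
    have /tnthP[j ->] : x \in in_tuple s by [].
    by exists j => //; have [] := WP j.
  exists (range A); split.
  - by apply: finite_image; exact: finite_finset.
  - by move=> _ [t _ <-]; have [] := AP t.
  move=> x gx.
  have /choice[t tP] i : exists j, W j (x i).
    have := gx i; rewrite gE /patch.
    by case: ifPn => [/set_mem [j _ Wj] _|_ /(_ Be0)//]; exists j.
  exists (A [ffun i => t i]); first by exists [ffun i => t i].
  apply: (MP _).2 => i; have [_ _ /(_ _ (tP i))] := WP (t i); apply.
  by rewrite ffunE.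
have [F [FY Fd]] := @sC Y dY.
have /choice[V VP] k : exists V, [/\ finite_set V, V `<=` U k &
    forall f, F k f -> supp f `<=` \bigcup_(A in V) A].
  have [finF FkY] := FY k.
  have /choice[V VP] f : exists V, F k f -> [/\ finite_set V, V `<=` U k &
      supp f `<=` \bigcup_(A in V) A].
    by have [/FkY[V]|nF] := pselect (F k f); [exists V|exists set0].
  exists (\bigcup_(f in F k) V f); split.
  - by apply: bigcup_finite => // f /VP[].
  - by move=> A [f /VP[_ + _]]; exact.
  move=> f Ff x fx; have [_ _ /(_ x fx)[A VA Ax]] := VP f Ff.
  by exists A => //; exists f.
exists V; split=> [k|]; first by have [] := VP k.
rewrite -subTset => x _.
(* That [x] lies in [supp f] is an open condition on [f], met by the constant [e1]; some selected
   [f] meets it as well. *)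
pose O := [set f : Cp X E | forall i, ~ B (f (x i))].
have [|W ->|k /(_ O erefl) [f [Of Fkf]]] := Fd [set O].
- exact: finite_set1.
- split; last first.
    have [g gE] := exists_Cp (@cst_continuous X E e1).
    by exists g => i; rewrite gE.
  rewrite openE => f Of; 
    rewrite /interior /=.
    apply: (@filter_forall _ _ (fun i (g : Cp X E) => ~ B (g (x i))) (nbhs f)).
    move=> i.
  exact: (nbhs_Cp_eval (nbhs_nB (Of i))).
have [_ _ /(_ f Fkf x Of) [A VA Ax]] := VP k.
by exists k => //; exists A.
Qed.

End necessity.

(** * Countable clopen separation from the Menger square *)

Lemma Menger_square_separation (X : topologicalType) (A B : set X) :
  has_clopen_base X -> accessible_space X -> Menger {ptws 'I_2 -> X} ->
  closed A -> closed B -> A `&` B = set0 ->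
  exists C : set (set X), [/\ countable C, C `<=` clopen &
    forall x y, A x -> B y -> exists2 W, C W & W x /\ ~ W y].
Proof.
move=> zX aX mX clA clB AB0.
pose p0 (p : {ptws 'I_2 -> X}) := p ord0.
pose p1 (p : {ptws 'I_2 -> X}) := p ord_max.
have c0 : continuous p0 by exact: (@proj_continuous _ (fun=> X) ord0).
have c1 : continuous p1 by exact: (@proj_continuous _ (fun=> X) ord_max).
(* The complement of the product of [A] and [B] is added to every member of the cover, so a point of
   that product can only be covered because [W] separates its coordinates. *)
pose O (W : set X) := (p0 @^-1` W `&` p1 @^-1` (~` W)) `|`
  (p0 @^-1` (~` A) `|` p1 @^-1` (~` B)).
have [n W [oW clW]|n p|F [Ff FO]] := @Menger_indexed _ _ (fun=> clopen) O mX.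
- apply: openU; last first.
    by apply: openU; apply: open_comp => //; exact: closed_openC.
  by apply: openI; apply: open_comp => //; exact: closed_openC.
- have [Ap|nAp] := pselect (A (p0 p)); last first.
    by exists setT; [exact: clopenT|right; left].
  have [Bp|nBp] := pselect (B (p1 p)); last first.
    by exists setT; [exact: clopenT|right; right].
  have [|W [cW W0 W1]] := clopen_separation (x := p0 p) (y := p1 p) zX aX.
    move=> p01; suff : set0 (p0 p) by [].
    by rewrite -AB0; split=> //; rewrite p01.
  by exists W => //; left.
exists (\bigcup_n F n); split.
- apply: bigcup_countable => // n _.
  by apply: finite_set_countable; exact: (Ff n).1.
- by move=> W [n _ /(Ff n).2].
move=> x y Ax By.
have [n [W FW OW]] := FO (fun i => if i == ord0 then x else y).
exists W; first by exists n.
by case: OW => [[]|[]].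
Qed.

(** The square minus the diagonal is a union of countably many closed products: closures of basic
    sets of the coarser regular topology, with disjoint factors. Each product needs only countably
    many clopen sets of [X]. *)
Lemma iw_eq_omega_Menger_separating (R : realType) (X : topologicalType) :
  has_clopen_base X -> accessible_space X -> iw_eq_omega X ->
  Menger {ptws 'I_2 -> X} ->
  exists C : set (set X), [/\ countable C, C `<=` clopen & separates_points C].
Proof.
move=> zX aX [tau [/= coarser [aX' crX'] [B Bcnt [oB nB]]]] mX.
set X' := Topological.Pack tau in coarser aX' crX' B Bcnt oB nB.
have rX' : regular_space X' := @completely_regular_regular R X' crX'.
have clX (A : set X') : closed (closure A) -> @closed X (@closure X' A).
  move=> cA; rewrite -openC; apply: coarser; rewrite openC; exact: cA.
pose ok (UV : set X' * set X') :=
  [/\ B UV.1, B UV.2 & @closure X' UV.1 `&` @closure X' UV.2 = set0].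
have /choice[C CP] (UV : set X' * set X') : exists C : set (set X),
    ok UV -> [/\ countable C, C `<=` @clopen X & forall x y,
      @closure X' UV.1 x -> @closure X' UV.2 y ->
      exists2 W, C W & W x /\ ~ W y].
  have [[_ _ UV0]|nUV] := pselect (ok UV); last by exists set0.
  have cl (A : set X') : @closed X (@closure X' A).
    by apply: clX; exact: closed_closure.
  have [C CP] := Menger_square_separation zX aX mX (cl UV.1) (cl UV.2) UV0.
  by exists C.
exists (\bigcup_(UV in ok) C UV); split.
- apply: bigcup_countable => [|UV /CP[] //].
  apply: (@sub_countable _ _ _ (B `*` B)); last exact: countableX.
  by apply: subset_card_le => UV [].
- by move=> W [UV /CP[_ + _]]; exact.
move=> x y xy.
have [A [oA /set_mem Ax /set_mem Ay]] :
    exists A : set X', [/\ open A, x \in A & y \in ~` A].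
  by apply: aX'; apply/eqP.
have [U nU clU] : filter_from (nbhs (x : X')) closure A.
  by apply: rX'; exact: open_nbhs_nbhs.
have [V nV clV] : filter_from (nbhs (y : X')) closure (~` closure U).
  apply: rX'; apply: open_nbhs_nbhs; split.
    exact/closed_openC/closed_closure.
  by move=> /clU.
have [U' [BU' U'x] U'U] := nB _ _ nU.
have [V' [BV' V'y] V'V] := nB _ _ nV.
have okUV : ok (U', V').
  split=> //; rewrite -subset0 => z [/(closureS U'U) zU /(closureS V'V) /clV].
  exact.
have [_ _ CUV] := CP _ okUV.
have [W CW Wxy] := CUV x y (subset_closure U'x) (subset_closure V'y).
by exists W => //; exists (U', V').
Qed.

(** * Sufficiency: interpolation and selection *)

Lemma Cp_interpolation (X E : topologicalType) (en : nat -> E)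
    (C : set (set X)) :
  (forall e, exists n, en n = e) ->
  countable C -> C `<=` clopen -> separates_points C ->
  exists d : seq (seq nat * nat) -> Cp X E,
    forall (s : seq X) (f : X -> E), exists c, forall x, x \in s -> d c x = f x.
Proof.
move=> en_surj Ccnt Cc Csep.
have [W [cW CW]] := countable_clopen_enum Ccnt Cc.
pose cyl (l : seq nat) : set X := foldr (fun n A => W n `&` A) setT l.
have cC l : clopen (cyl l).
  by elim: l => [|n l IH]; [exact: clopenT|exact: clopenI].
have isolate (x : X) (s : seq X) :
    exists l, cyl l x /\ forall y, y \in s -> y <> x -> ~ cyl l y.
  elim: s => [|y s [l [lx ls]]]; first by exists [::].
  have [->|yx] := pselect (y = x).
    by exists l; split=> // z; rewrite inE => /predU1P[->|/ls].
  have [_ /CW[n _ <-] [Wx Wy]] := Csep x y (nesym yx).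
  exists (n :: l); split=> // z; rewrite inE => /predU1P[-> _ []//|/ls zl zx].
  by case=> _; exact: zl.
(* A code lists cylinders with the index of a value; earlier entries override later ones, and [en 0]
   is the default value. *)
pose D (c : seq (seq nat * nat)) : X -> E :=
  foldr (fun lv h => patch h (cyl lv.1) (cst (en lv.2))) (cst (en 0)) c.
have cD c : continuous (D c).
  elim: c => [|lv c IH]; first exact: cst_continuous.
  by apply: continuous_patch => //; exact: cst_continuous.
have /choice[d dE] c := exists_Cp (cD c).
exists d => s f; elim: s => [|x s [c cs]]; first by exists [::].
have [l [lx ls]] := isolate x s; have [v vE] := en_surj (f x).
(* The new head isolates [x] within [s], so the values at the other points of [s] do not change. *)
exists ((l, v) :: c) => y; rewrite dE /= /patch inE.
case: ifPn => [/set_mem ly|/negP ly].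
  move=> /predU1P[->//|ys]; rewrite /cst vE.
  by have [->//|yx] := pselect (y = x); case: (ls y).
by move=> /predU1P[yx|/cs]; [case: ly; rewrite yx mem_set|rewrite dE].
Qed.

Lemma seq_nat_bound (I : eqType) (s : seq I) (h : I -> nat) :
  exists m, forall i, i \in s -> (h i <= m)%N.
Proof. by exists (\max_(i <- s) h i) => i si; exact: leq_bigmax_seq. Qed.

(** Continuity of [iota] makes closeness of real values an open condition; the second hypothesis
    turns closeness back into membership in neighbourhoods of [E]. *)
Lemma S_separable_Cp (R : realType) (X E : topologicalType) (K : countType)
    (iota : E -> R) (d : K -> Cp X E) :
  continuous iota ->
  (forall e A, nbhs e A -> exists q : nat, forall e' : E,
    `|iota e' - iota e| < q.+1%:R^-1 -> A e') ->
  (forall (s : seq X) (f : X -> E),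
    exists k, forall x, x \in s -> d k x = f x) ->
  (forall n, Menger {ptws 'I_n -> X}) ->
  S_separable (Cp X E).
Proof.
move=> ciota iotaN dP mX Y dY.
pose O (a : seq K * nat * nat) (G : K -> Cp X E) : set {ptws 'I_a.1.2 -> X} :=
  [set x | forall k, k \in a.1.1 -> forall i,
    `|iota (G k (x i)) - iota (d k (x i))| < a.2.+1%:R^-1].
(* The dense sets with indices [pickle (a, n)] are reserved for [a]. Injectivity of [pickle] gives
   each index to at most one pair, which keeps the final selection finite. *)
have /choice[F FP] (a : seq K * nat * nat) :
    exists F : nat -> set (K -> Cp X E),
    (forall n, finite_set (F n) /\
      F n `<=` [set G | forall k, Y (pickle (a, n)) (G k)]) /\
    forall x, exists n, exists2 G, F n G & O a G x.
  apply: (Menger_indexed (mX a.1.2)) => [n G _|n x].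
    rewrite openE => x Ox; rewrite /interior /=.
    apply: (@filter_mem_seq _ _ (nbhs x) a.1.1 (fun k y => forall i,
      `|iota (G k (y i)) - iota (d k (y i))| < a.2.+1%:R^-1)) => k ka.
    apply: (@filter_forall _ _ (fun i y =>
      `|iota (G k (y i)) - iota (d k (y i))| < a.2.+1%:R^-1) (nbhs x)) => i.
    pose Z : topologicalType := {ptws 'I_a.1.2 -> X}.
    have cev (g : Cp X E) : continuous (fun y : Z => iota (g (y i))).
      move=> y; apply: (@continuous_comp Z E R (fun y : Z => g (y i)) iota).
        apply: (@continuous_comp Z X E (fun y : Z => y i) g).
          exact: (@proj_continuous _ (fun=> X) i).
        exact: cts_fun.
      exact: ciota.
    have cdist : continuous (fun y : Z =>
        `|iota (G k (y i)) - iota (d k (y i))|).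
      by move=> y; exact: (cvg_norm (cvgB (cev (G k) y) (cev (d k) y))).
    apply: (cdist x [set r | r < a.2.+1%:R^-1]); apply: open_nbhs_nbhs.
    by split; [exact: open_lt|exact: Ox].
  have /choice[G GP] k : exists g : Cp X E, Y (pickle (a, n)) g /\
      forall i, `|iota (g (x i)) - iota (d k (x i))| < a.2.+1%:R^-1.
    pose V := [set g : Cp X E | forall i,
      `|iota (g (x i)) - iota (d k (x i))| < a.2.+1%:R^-1].
    have [||g [Vg Yg]] := dY (pickle (a, n)) V; last by exists g.
      by exists (d k) => i; rewrite subrr normr0 invr_gt0 ltr0n.
    rewrite openE => g Vg; rewrite /interior /=.
    apply: (@filter_forall _ _ (fun i (h : Cp X E) =>
      `|iota (h (x i)) - iota (d k (x i))| < a.2.+1%:R^-1) (nbhs g)) => i.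
    have cdist : continuous (fun e => `|iota e - iota (d k (x i))|).
      by move=> e; exact: (cvg_norm (cvgB (ciota e) (cvg_cst _))).
    apply: (@nbhs_Cp_eval _ _ _ _
      [set e | `|iota e - iota (d k (x i))| < a.2.+1%:R^-1]).
    apply: (cdist (g (x i)) [set r | r < a.2.+1%:R^-1]); apply: open_nbhs_nbhs.
    by split; [exact: open_lt|exact: Vg].
  by exists G => [k|k _]; have [] := GP k.
exists (fun n => \bigcup_(an in pickle @^-1` [set n])
  \bigcup_(G in F an.1 an.2) (G @` [set` an.1.1.1])).
split=> [n|C Cfin CU].
  split.
    apply: bigcup_finite => [|an _].
      apply: finite_preimage (finite_set1 n) => x y _ _.
      exact: (pcan_inj pickleK).
    apply: bigcup_finite => [|G _]; first exact: ((FP an.1).1 _).1.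
    by apply: finite_image; exact: finite_seq.
  move=> _ [[a m] /= <- [G FG [k _ <-]]].
  exact: (((FP a).1 m).2 G FG k).
(* Any index serves the empty collection. Otherwise a member supplies [f0], from which a default
   element of [K] is obtained. *)
have [[U0 CU0]|nC] := pselect (C !=set0); last first.
  by exists 0 => U CU'; case: nC; exists U.
have [_ [f0 _]] := CU U0 CU0.
have /choice[t tP] U : exists t : K * seq X * nat, C U -> forall g : Cp X E,
    (forall x, x \in t.1.2 ->
      `|iota (g x) - iota (d t.1.1 x)| < t.2.+1%:R^-1) -> U g.
  have [/CU[oU [f Uf]]|nCU] := pselect (C U); last first.
    have [k _] := dP [::] f0.
    by exists (k, [::], 0).
  have /nbhs_CpP[s [ N [fN sub]]] : nbhs f U by exact: open_nbhs_nbhs.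
  have /choice[q qP] x := iotaN _ _ (fN x).
  have [m mP] := seq_nat_bound s q; have [k kP] := dP s f.
  exists (k, s, m) => _ g /= gP; apply: sub => x xs; apply: qP.
  rewrite -(kP x xs); apply: lt_le_trans (gP x xs) _.
  by rewrite lef_pV2 ?posrE ?ltr0n// ler_nat ltnS mP.
have /finite_seqP[s Cs] := Cfin.
have [q qP] := seq_nat_bound s (fun U => (t U).2).
(* All the finite sets are concatenated into a single point of one power, with the largest
   precision; a single [G] close to the [d k] there serves every [U] at the same index. *)
pose pts := flatten [seq (t U).1.2 | U <- s].
pose a := ([seq (t U).1.1 | U <- s], size pts, q).
have [n [G FG OG]] := (FP a).2 (tnth (in_tuple pts)).
exists (pickle (a, n)) => U CU'; have sU : U \in s by rewrite Cs in CU'.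
have kU : (t U).1.1 \in a.1.1 by apply/mapP; exists U.
exists (G (t U).1.1); split; last first.
  by exists (a, n) => //; exists G => //; exists (t U).1.1.
apply: tP => // x xU.
have /tnthP[i ->] : x \in in_tuple pts.
  by apply/flattenP; exists (t U).1.2 => //; apply/mapP; exists U.
apply: lt_le_trans (OG _ kU i) _.
by rewrite lef_pV2 ?posrE ?ltr0n// ler_nat ltnS qP.
Qed.

(** * The criterion for the three targets *)

Lemma S_separable_CpP (R : realType) (X E : topologicalType) (B : set E)
    (e0 e1 : E) (iota : E -> R) (en : nat -> E) :
  has_clopen_base X -> accessible_space X ->
  clopen B -> B e0 -> ~ B e1 ->
  continuous iota ->
  (forall e A, nbhs e A -> exists q : nat, forall e' : E,
    `|iota e' - iota e| < q.+1%:R^-1 -> A e') ->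
  (forall e, exists n, en n = e) ->
  S_separable (Cp X E) <->
  iw_eq_omega X /\ (forall n : nat, Menger {ptws 'I_n -> X}).
Proof.
move=> zX aX cB Be0 Be1 ciota iotaN en_surj; split=> [sC|[iwX mX]].
  split; last exact: (S_separable_Cp_Menger zX cB Be0 Be1 sC).
  have [C [Ccnt Cc Csep]] := S_separable_Cp_separating zX aX cB Be0 Be1 sC.
  exact: (iw_eq_omega_separating R Ccnt Cc Csep).
have [C [Ccnt Cc Csep]] := iw_eq_omega_Menger_separating R zX aX iwX (mX 2).
have [d dP] := Cp_interpolation en_surj Ccnt Cc Csep.
exact: (S_separable_Cp ciota iotaN dP mX).
Qed.

(** A real number [c] outside the range of [iota] cuts the space into two clopen halves, since
    strict and large inequality with [c] agree. *)
Lemma S_separable_Cp_initialP (R : realType) (X : topologicalType)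
    (S : countType) (iota : S -> R) (c : R) (e0 e1 : S) :
  has_clopen_base X -> accessible_space X ->
  (forall e, iota e != c) -> iota e0 < c -> c < iota e1 ->
  S_separable (Cp X (initial_topology iota)) <->
  iw_eq_omega X /\ (forall n : nat, Menger {ptws 'I_n -> X}).
Proof.
move=> zX aX nc e0c ce1; pose E : topologicalType := initial_topology iota.
have ciota : continuous (iota : E -> R) by exact: initial_continuous.
apply: (@S_separable_CpP R X E [set e | iota e < c] e0 e1 iota
  (fun n => odflt e0 (unpickle n))) => //.
- split; first exact: (open_comp (fun e _ => ciota e) (@open_lt R c)).
  have -> : [set e | iota e < c] = [set e : E | iota e <= c].
    by apply/seteqP; split=> e /=; rewrite le_eqVlt (negPf (nc e)).
  exact: (preimage_closed (fun e _ => ciota e) (@closed_le R c)).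
- by rewrite /= ltNge (ltW ce1).
- move=> e A [_ [[V oV <-] Ve VA]].
  have /nbhs_ballP[r /= r0 rV] : nbhs (iota e) V by exact: open_nbhs_nbhs.
  have [q _ /(_ q (leqnn q)) /= qr] := near_infty_natSinv_lt (PosNum r0).
  exists q => e' e'e; apply: VA; apply: rV => /=.
  by rewrite /ball /= distrC; apply: lt_trans qr.
- by move=> e; exists (pickle e); rewrite pickleK.
Qed.

Lemma S_separable_Cp_boolP (R : realType) (X : topologicalType) :
  has_clopen_base X -> accessible_space X ->
  S_separable (Cp X bool) <->
  iw_eq_omega X /\ (forall n : nat, Menger {ptws 'I_n -> X}).
Proof.
move=> zX aX.
apply: (@S_separable_CpP R X bool [set false] false true (fun b => b%:R) odd)
  => //.
- by split; [exact: discrete_open|exact: discrete_closed].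
- by apply/continuousP => A _; exact: discrete_open.
(* Precision 0 suffices: two booleans at distance less than 1 are equal. *)
- move=> b A /nbhs_singleton Ab; exists 0%N => b'.
  by case: b b' Ab => -[] // Ab;
    rewrite ?subr0 ?sub0r ?normrN invr1 normr1 ltxx.
- by case; [exists 1%N|exists 0%N].
Qed.

Lemma ratr_neq_pi (R : realType) (q : rat) : ratr q != pi :> R.
Proof.
apply/eqP => qpi; apply: (@pi_irrationnal R); rewrite -qpi.
by exists q.
Qed.

Theorem theorem3p36 (R : realType) (X : topologicalType)
    (zdX : has_clopen_base X) (tX : tychonoff_space X) :
  [<-> S_separable (Cp X (usual_rat R));
       S_separable (Cp X (usual_int R));
       S_separable (Cp X bool);
       iw_eq_omega X /\ (forall n : nat, Menger {ptws 'I_n -> X})].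
Proof.
have [aX _] := tX.
(* The irrational number [pi] cuts both the rationals and the integers, with 0 below it and [m]
   above. *)
pose m : nat := Num.bound (pi : R).
have pi_lt_m : pi < m%:R :> R by rewrite archi_boundP// pi_ge0.
have ratP :=
  @S_separable_Cp_initialP R X rat (fun q => ratr q) pi 0 m%:R zdX aX.
have intP :=
  @S_separable_Cp_initialP R X int (fun z => z%:~R) pi 0 m%:R zdX aX.
have {}ratP : S_separable (Cp X (usual_rat R)) <->
    iw_eq_omega X /\ (forall n : nat, Menger {ptws 'I_n -> X}).
  by apply: ratP; rewrite ?rmorph0 ?pi_gt0 ?ratr_nat// => q; exact: ratr_neq_pi.
have {}intP : S_separable (Cp X (usual_int R)) <->
    iw_eq_omega X /\ (forall n : nat, Menger {ptws 'I_n -> X}).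
  apply: intP; rewrite ?pi_gt0 ?natz -?pmulrn// => z.
  by rewrite -ratr_int ratr_neq_pi.
have twoP := S_separable_Cp_boolP R zdX aX.
tfae.
- by move=> /ratP /intP.
- by move=> /intP /twoP.
- by move=> /twoP.
- by move=> /ratP.
Qed.
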